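(* There exists a Tychonoff weakly Lindelöf topological space $X$ which does not have the property $^*\mathcal{U}_{fin}(\mathcal{O},\mathcal{O})$.
   Context: Let $X$ be a topological space. $\mathcal{O}$ denotes the family of all open covers of $X$, $\omega$ denotes the first infinite cardinal, and $cl_X(A)$ denotes the closure of $A$ in $X$. For a subset $A$ of $X$ and a family $\mathcal{U}$ of subsets of $X$, set $St(A,\mathcal{U})=\bigcup\{U\in\mathcal{U}: U\cap A\neq\emptyset\}$. $X$ is weakly Lindelöf if for every open cover $\mathcal{U}$ of $X$ there exists a countable subfamily $\mathcal{V}$ of $\mathcal{U}$ such that $cl_X(\bigcup\mathcal{V})=X$. $X$ has the property $^*\mathcal{U}_{fin}(\mathcal{O},\mathcal{O})$ if for each sequence $(\mathcal{U}_n:n\in\omega)$ of elements of $\mathcal{O}$ there is a sequence $(\mathcal{V}_n:n\in\omega)$ such that for each $n\in\omega$, $\mathcal{V}_n$ is a finite subset of $\mathcal{U}_n$, and $\{St(\bigcup_{i\in\omega}(\bigcup\mathcal{V}_i),\mathcal{U}_n):n\in\omega\}\in\mathcal{O}$ (i.e. this family is an open cover of $X$). Note that the star is taken around the union of all the sets $\bigcup\mathcal{V}_i$, $i\in\omega$, for every $n$. Tychonoff means completely regular and Hausdorff. *)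

(* Defs.v *)
From mathcomp Require Import all_boot all_order all_algebra.
From mathcomp Require Import all_classical all_reals all_analysis.

Set Implicit Arguments.
Unset Strict Implicit.
Unset Printing Implicit Defensive.

Local Open Scope classical_set_scope.

(* The library states complete regularity with [uniform_separator]; by
   [uniform_separatorP] this is the existence, for every closed [B] and
   [a] outside [B], of a continuous real-valued function with values in [0, 1]
   that is 0 at [a] and 1 on [B]. *)
Definition tychonoff_space (X : topologicalType) : Prop :=
  completely_regular_space X /\ hausdorff_space X.

Definition open_cover (X : topologicalType) (U : set (set X)) : Prop :=
  U `<=` open /\ \bigcup_(A in U) A = setT.

Definition star (X : Type) (A : set X) (U : set (set X)) : set X :=
  \bigcup_(B in [set B | U B /\ B `&` A !=set0]) B.

Definition weakly_lindelof (X : topologicalType) : Prop :=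
  forall U : set (set X), open_cover U ->
  exists V : set (set X),
    [/\ V `<=` U, countable V & closure (\bigcup_(A in V) A) = setT].

(* The property ^*U_fin(O, O): the same set, the union of all the [V i], is
   starred for every [n]. *)
Definition star_Ufin (X : topologicalType) : Prop :=
  forall U : nat -> set (set X), (forall n, open_cover (U n)) ->
  exists V : nat -> set (set X),
    (forall n, V n `<=` U n /\ finite_set (V n)) /\
    open_cover
      (range (fun n => star (\bigcup_i \bigcup_(A in V i) A) (U n))).

(* Main.v *)
Require Import Defs.
From HB Require Import structures.
From mathcomp Require Import all_boot all_order all_algebra.
From mathcomp Require Import finmap.
From mathcomp Require Import all_classical all_reals all_analysis.

(** The counterexample is the Pixley-Roy hyperspace of the Baire space
    [nat -> nat]: its points are the finite sets [F] of sequences, and the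
    basic neighbourhoods of [F] consist of the finite sets [G] that contain [F]
    and lie in a given neighbourhood of [F] in the Baire space.  Write [F|n]
    for the set of the initial segments of length [n] of the members of [F].
    The neighbourhoods [B n F] of all [G] with [F] included in [G] and
    [G|n = F|n] form a base at [F].

    The space is Tychonoff because its basic neighbourhoods are clopen.

    It is weakly Lindelof because it is sigma-centered: if [F|n = G|n], then
    the union of [F] and [G] belongs to both [B n F] and [B n G].  There are
    only countably many pairs [(n, F|n)].  Given an open cover, selecting, for
    each pair where this is possible, one member of the cover that includes a
    set [B n F] yields a countable subfamily with dense union.

    The failure of the star selection property comes from the failure of the
    Menger property in the Baire space.  Take for [U_n] the cover by all sets
    [B n.+1 F].  The members of the elements of a set [B i.+1 F] have bounded
    [i]-th term, so finite selections [V_i] give bounds [m i].  Put [x i = m i].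
    No member of the union of all the sets in the [V_i] contains [x].  On the
    other hand, if [{x}] lies in [B n.+1 F], then [F = {x}], so all the elements
    of this neighbourhood contain [x].  Hence no star covers [{x}]. *)

Set Implicit Arguments.
Unset Strict Implicit.
Unset Printing Implicit Defensive.

Local Open Scope classical_set_scope.

(** * Clopen sets and complete regularity *)

(** The uniformity required by [uniform_separator] is pulled back from the
    discrete space [bool] along the indicator function of [U]. *)
Lemma clopen_uniform_separator (T : topologicalType) (A B U : set T) :
  clopen U -> A `<=` U -> B `<=` ~` U -> uniform_separator A B.
Proof.
move=> [oU cU] AU BU; pose f (x : T) : bool := `[< U x >].
pose T' : uniformType := initial_topology f.
exists (Uniform.class T'), [set xy | f xy.1 = f xy.2]; split.
- exists [set xy | xy.1 = xy.2]; last by case.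
  by rewrite uniform_discrete => _ [x _ <-].
- rewrite -subset0 => -[a b [[/= /AU Ua /BU Ub]]] fab; apply: Ub.
  by apply/asboolP; rewrite -/(f b) -fab; apply/asboolP.
- move=> x W [V [[Q oQ <- /=]] Qfx] /filterS; apply.
  have [Ux|nUx] := pselect (U x).
    have fx : f x = true by apply/asboolP.
    apply: filterS (open_nbhs_nbhs (conj oU Ux)) => y Uy.
    rewrite /preimage /=; have -> : f y = f x by rewrite fx; apply/asboolP.
    exact: Qfx.
  have fx : f x = false by apply/asboolP.
  have oC : open (~` U) by exact: closed_openC.
  apply: filterS (open_nbhs_nbhs (conj oC nUx)) => y nUy.
  rewrite /preimage /=; have -> : f y = f x by rewrite fx; apply/asboolP.
  exact: Qfx.
Qed.

Lemma clopen_base_tychonoff (T : topologicalType) :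
  (forall (x : T) (A : set T), nbhs x A ->
     exists U, [/\ clopen U, U x & U `<=` A]) ->
  (forall x y : T, x != y -> exists U, [/\ clopen U, U x & ~ U y]) ->
  tychonoff_space T.
Proof.
move=> base sep; split.
  move=> a B cB nBa.
  have [U [clU Ua UB]] := base a (~` B)
    (open_nbhs_nbhs (conj (closed_openC cB) nBa)).
  apply: (clopen_uniform_separator clU) => [_ ->//|b Bb Ub].
  exact: UB Ub Bb.
move=> p q pq; apply/eqP; apply: contraPT pq => /sep[U [[oU cU] Up nUq]] /(_ U).
move=> /(_ (~` U) (open_nbhs_nbhs (conj oU Up))).
by move=> /(_ (open_nbhs_nbhs (conj (closed_openC cU) nUq)))[z []].
Qed.

(** * The Pixley-Roy space of the Baire space *)

(** The hyperspace is usually restricted to nonempty finite sets; the empty set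
    adds one isolated point. *)
Definition pixley_roy := {fset (nat -> nat)}.

HB.instance Definition _ := Choice.on pixley_roy.

Definition prefixes (n : nat) (F : pixley_roy) : {fset seq nat} :=
  [fset mkseq x n | x : nat -> nat in F]%fset.

Definition pr_base (n : nat) (F : pixley_roy) : set pixley_roy :=
  [set G | (F `<=` G)%fset /\ prefixes n G = prefixes n F].

Lemma prefixesP n (F : pixley_roy) (x : nat -> nat) : x \in F ->
  mkseq x n \in prefixes n F.
Proof. by move=> xF; apply/imfsetP; exists x. Qed.

Lemma eq_mkseq_le n m (x y : nat -> nat) : n <= m ->
  mkseq x m = mkseq y m -> mkseq x n = mkseq y n.
Proof.
by move=> nm /(congr1 (take n)); rewrite -!map_take take_iota (minn_idPl nm).
Qed.

Lemma eq_prefixes_le n m (F G : pixley_roy) : n <= m ->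
  prefixes m F = prefixes m G -> prefixes n F = prefixes n G.
Proof.
move=> nm; have sub (H K : pixley_roy) : prefixes m H = prefixes m K ->
    (prefixes n H `<=` prefixes n K)%fset.
  move=> HK; apply/fsubsetP => _ /imfsetP[x /= xH ->].
  have /imfsetP[y /= yK xy] : mkseq x m \in prefixes m K.
    by rewrite -HK; exact: prefixesP.
  by rewrite (eq_mkseq_le nm xy); exact: prefixesP.
by move=> FG; apply/eqP; rewrite eqEfsubset !sub.
Qed.

Lemma pr_base_refl n F : pr_base n F F.
Proof. by split. Qed.

(** This makes every [pr_base n F] a neighbourhood of each of its points. *)
Lemma pr_base_trans n F G : pr_base n F G -> pr_base n G `<=` pr_base n F.
Proof.
move=> [FG eFG] H [GH eGH]; split; first exact: fsubset_trans GH.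
by rewrite eGH.
Qed.

Lemma pr_base_le n m F : n <= m -> pr_base m F `<=` pr_base n F.
Proof. by move=> nm G [FG eFG]; split => //; exact: eq_prefixes_le eFG. Qed.

Definition pr_nbhs (F : pixley_roy) : set_system pixley_roy :=
  filter_from setT (pr_base ^~ F).

HB.instance Definition _ := hasNbhs.Build pixley_roy pr_nbhs.

Lemma pr_nbhs_filter (F : pixley_roy) : ProperFilter (nbhs F).
Proof.
apply: filter_from_proper; last by move=> n _; exists F; exact: pr_base_refl.
apply: filter_from_filter; first by exists 0.
move=> n m _ _; exists (maxn n m) => // G FG.
by split; apply: pr_base_le FG; rewrite ?leq_maxl ?leq_maxr.
Qed.

Lemma pr_nbhs_singleton (F : pixley_roy) (A : set pixley_roy) :
  nbhs F A -> A F.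
Proof. by move=> [n _]; apply; exact: pr_base_refl. Qed.

Lemma pr_nbhs_nbhs (F : pixley_roy) (A : set pixley_roy) :
  nbhs F A -> nbhs F (nbhs^~ A).
Proof.
move=> [n _ FA]; exists n => // G FG; exists n => //.
exact: subset_trans (pr_base_trans FG) FA.
Qed.

HB.instance Definition _ := Nbhs_isNbhsTopological.Build pixley_roy
  pr_nbhs_filter pr_nbhs_singleton pr_nbhs_nbhs.

Lemma pr_base_open n F : open (pr_base n F).
Proof. by rewrite openE => G FG; exists n => //; exact: pr_base_trans. Qed.

(** Distinct sequences differ at some index, and [G] is finite. *)
Lemma prefixes_sep (G : pixley_roy) (x : nat -> nat) : x \notin G ->
  exists n, mkseq x n \notin prefixes n G.
Proof.
move=> xG.
have /choice[k kP] : forall y : nat -> nat, exists k, y \in G -> x k != y k.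
  move=> y; have [xy|xy] := pselect (exists k, x k != y k).
    by case: xy => k xy; exists k.
  exists 0 => yG; apply: contraNT xG => _; suff -> : x = y by [].
  by apply/funext => k; apply/eqP; apply: contra_notT xy => xy; exists k.
exists (\max_(y <- G) k y).+1; apply/imfsetP => -[y /= yG].
have lek : k y < (\max_(y <- G) k y).+1 by rewrite ltnS; exact: leq_bigmax_seq.
move=> /(congr1 (fun s => nth 0 s (k y))); rewrite !nth_mkseq//.
by apply/eqP; exact: kP.
Qed.

Lemma mem_clopen (x : nat -> nat) : clopen [set F : pixley_roy | x \in F].
Proof.
split; first by rewrite openE => F xF; exists 0 => // G [/fsubsetP + _]; apply.
rewrite -openC openE => F /negP/prefixes_sep[n xF]; exists n => // G [_ FG].
by move=> /(prefixesP n); rewrite FG; exact/negP.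
Qed.

(** The condition [F `<=` G] is clopen in [G] by [mem_clopen], and
    [prefixes n G] is constant on the neighbourhood [pr_base n G]. *)
Lemma pr_base_clopen n F : clopen (pr_base n F).
Proof.
split; first exact: pr_base_open.
rewrite -openC openE => G nFG.
have [eFG|eFG] := eqVneq (prefixes n G) (prefixes n F).
  have /fsubsetPn[x xF xG] : ~~ (F `<=` G)%fset.
    by apply/negP => FG; exact: nFG (conj FG eFG).
  have [_ /closed_openC] := mem_clopen x.
  rewrite openE => /(_ G (negP xG)); apply: filterS => H /= xH [/fsubsetP FH _].
  exact: xH (FH _ xF).
exists n => // H [_ eGH] [_ eFH].
by move/eqP: eFG; apply; rewrite -eGH -eFH.
Qed.

Lemma pixley_roy_tychonoff : tychonoff_space pixley_roy.
Proof.
apply: clopen_base_tychonoff => [F A [n _ FA]|F G FG].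
  exists (pr_base n F); split => //; exact: pr_base_clopen.
have : ~~ ((F `<=` G)%fset && (G `<=` F)%fset) by rewrite -eqEfsubset.
rewrite negb_and => /orP[] /fsubsetPn[x xF xG].
  by exists [set H : pixley_roy | x \in H]; split => //;
    [exact: mem_clopen|exact/negP].
exists (~` [set H : pixley_roy | x \in H]); split => /=.
- exact: clopenC setT (mem_clopen x).
- exact/negP.
- by [].
Qed.

(** * Weak Lindelofness *)

Lemma pr_base_fsetU n (F G : pixley_roy) : prefixes n F = prefixes n G ->
  pr_base n F (F `|` G)%fset.
Proof.
move=> eFG; split; first exact: fsubsetUl.
by rewrite /prefixes imfsetU -/(prefixes n F) -/(prefixes n G) -eFG fsetUid.
Qed.

Lemma pixley_roy_weakly_lindelof : weakly_lindelof pixley_roy.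
Proof.
move=> U [oU cU].
pose P (c : nat * {fset seq nat}) (W : set pixley_roy) :=
  U W /\ exists2 F, prefixes c.1 F = c.2 & pr_base c.1 F `<=` W.
have /choice[u uP] : forall c, exists W, (exists W', P c W') -> P c W.
  move=> c; have [[W PW]|nP] := pselect (exists W, P c W); first by exists W.
  by exists set0 => /nP.
exists (u @` [set c | exists W, P c W]); split.
- by move=> _ [c /uP[Uc _] <-].
- exact: sub_countable (card_image_le _ _) (countableP _).
rewrite -subTset => G _ A [n _ GA].
have [W UW WG] : (\bigcup_(W in U) W) G by rewrite cU.
have := oU _ UW; rewrite openE => /(_ _ WG)[m _ GW].
pose k := maxn n m; pose c := (k, prefixes k G).
have Pc : exists W', P c W'.
  exists W; split => //; exists G => //.
  by apply: subset_trans GW; exact/pr_base_le/leq_maxr.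
have [_ [F /= eFG Fu]] := uP _ Pc.
(* [u c] includes [pr_base k F] for some [F] with the same code as [G]; the
   union of [F] and [G] then lies in [u c] and in the neighbourhood of [G]. *)
exists (F `|` G)%fset; split; last first.
  apply: GA; apply: (pr_base_le (leq_maxl n m)); rewrite fsetUC.
  exact: pr_base_fsetU.
by exists (u c); [exists c|apply: Fu; exact: pr_base_fsetU].
Qed.

(** * Failure of the star selection property *)

(** In [pr_base i.+1 F] the [i]-th terms are those of the members of [F]. *)
Lemma pr_base_bounded i (F : pixley_roy) : exists m, forall G x,
  pr_base i.+1 F G -> x \in G -> x i < m.
Proof.
exists (\max_(y <- F) (y i)).+1 => G x [_ eFG] /(prefixesP i.+1).
rewrite eFG => /imfsetP[y /= yF] /(congr1 (fun s => nth 0 s i)).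
rewrite !nth_mkseq// => ->; rewrite ltnS.
exact: (leq_bigmax_seq (F := fun y : nat -> nat => y i)).
Qed.

Lemma finite_base_bounded i (V : set (set pixley_roy)) : finite_set V ->
  V `<=` range (pr_base i.+1) ->
  exists m, forall A G x, V A -> A G -> x \in G -> x i < m.
Proof.
move=> finV VB.
have /choice[k kP] : forall A, exists m, V A ->
    forall (G : pixley_roy) x, A G -> x \in G -> x i < m.
  move=> A; have [VA|nVA] := pselect (V A); last by exists 0.
  have [F _ <-] := VB _ VA; have [m mP] := pr_base_bounded i F.
  by exists m => _ G x; exact: mP.
exists (\max_(A <- fset_set V) k A) => A G x VA AG xG.
apply: leq_trans (kP A VA G x AG xG) _.
by apply: leq_bigmax_seq => //; rewrite in_fset_set// inE.
Qed.

Lemma pixley_roy_not_star_Ufin : ~ star_Ufin pixley_roy.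
Proof.
pose U n : set (set pixley_roy) := range (pr_base n.+1).
move=> /(_ U)[n|V [VU [_ cV]]].
  split=> [_ [F _ <-]|]; first exact: pr_base_open.
  rewrite -subTset => F _; exists (pr_base n.+1 F); first by exists F.
  exact: pr_base_refl.
have /choice[x xP] : forall i, exists m, forall A (G : pixley_roy) y,
    V i A -> A G -> y \in G -> y i < m.
  by move=> i; have [Vi fV] := VU i; exact: finite_base_bounded.
have : [set: pixley_roy] [fset x]%fset by [].
rewrite -cV => -[_ [n _ <-] [_ [[F _ <-] [H [FH [i _ [A VA AH]]]]] [Fx eFx]]].
have xF : x \in F.
  (* The prefixes of [F] are those of [{x}], so [F] is not empty. *)
  have /imfsetP[y /= yF _] : mkseq x n.+1 \in prefixes n.+1 F.
    by rewrite -eFx; apply: prefixesP; rewrite inE.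
  by have := fsubsetP Fx _ yF; rewrite inE => /eqP <-.
have xH : x \in H by case: FH => /fsubsetP + _; apply.
by have := xP i A H x VA AH xH; rewrite ltnn.
Qed.

Theorem mainTheorem1 :
  exists X : topologicalType,
    [/\ tychonoff_space X, weakly_lindelof X & ~ star_Ufin X].
Proof.
exists pixley_roy; split.
- exact: pixley_roy_tychonoff.
- exact: pixley_roy_weakly_lindelof.
- exact: pixley_roy_not_star_Ufin.
Qed.
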